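(* Let $G$ be a graph and let $s\ge 1$ be an integer. Then there is a rooted graph $G'$, formed from $G$ by adding one new vertex $\rho$ (the root) joined to vertices of $G$ by exactly $s$ edges in total (parallel edges allowed), such that $$B(G')\le \frac12 A(G)+\frac{1}{2s}A(G)+\frac1s .$$
   Context: A graph means a finite graph, possibly with multiple (parallel) edges. Each edge is regarded as a unit resistor, and $R_{xy}$ denotes the effective resistance between vertices $x,y$ ($R_{xx}=0$, and $R_{xy}=\infty$ if $x,y$ lie in different components). For a graph $G$ with vertex set $V=\{1,\dots,n\}$, $n\ge2$, $A(G)=\frac{1}{\binom n2}\sum_{x<y}R_{xy}(G)$ (so $A(G)=\infty$ if $G$ is disconnected, in which case the inequality is vacuous). For a graph $H$ with a designated root vertex $\rho$, $B(H)=\frac{1}{|V(H)|-1}\sum_{x\in V(H)}R_{\rho x}(H)$. *)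

(* Defs.v *)
From mathcomp Require Import all_boot all_order all_algebra.
From mathcomp Require Import boolp classical_sets constructive_ereal reals ereal.
From mathcomp Require Import ring lra.

Set Implicit Arguments.
Unset Strict Implicit.
Unset Printing Implicit Defensive.

Import Order.TTheory GRing.Theory Num.Theory.

Local Open Scope classical_set_scope.
Local Open Scope ring_scope.

(* Finite multigraphs without loops; [mult G x y] is the number of parallel
   edges between [x] and [y]. *)
Record mgraph (V : finType) := MGraph {
  mult : V -> V -> nat;
  mult_sym : forall x y, mult x y = mult y x;
  mult_irr : forall x, mult x x = 0%N
}.

Section Resistance.
Variables (R : realType) (V : finType) (G : mgraph V).
Implicit Types (x y z w : V) (v : V -> R).

Definition adj : rel V := [rel x y | (0 < mult G x y)%N].

(* The potential [v] satisfies Ohm's and Kirchhoff's laws when every edge has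
   resistance 1 and a unit current enters at [x] and leaves at [y]: the net
   current out of [z] is 1 at [x], -1 at [y] and 0 elsewhere (and 0 everywhere
   if [x = y]). *)
Definition unit_potential x y v : Prop :=
  forall z, \sum_w (mult G z w)%:R * (v z - v w) = (z == x)%:R - (z == y)%:R.

(* The potential drop does not depend on the choice of the unit potential
   ([unit_potential_uniq]), and a unit potential exists whenever [x] and [y] lie
   in the same component ([unit_potential_exists]); hence [eff_resE]. *)
Definition eff_res x y : \bar R :=
  if connect adj x y then (xget 0 [set v x - v y | v in unit_potential x y])%:E
  else +oo%E.

(* Meaningful for at least two vertices. *)
Definition rooted_average (rho : V) : \bar R :=
  ((#|V|.-1)%:R^-1%:E * \sum_x eff_res rho x)%E.

Lemma dirichlet v v' :
  \sum_z v' z * \sum_w (mult G z w)%:R * (v z - v w) =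
  2^-1 * \sum_z \sum_w (mult G z w)%:R * ((v' z - v' w) * (v z - v w)).
Proof.
set S := LHS.
have E1 : S = \sum_z \sum_w (mult G z w)%:R * (v' z * (v z - v w)).
  by apply: eq_bigr => z _; rewrite mulr_sumr; apply: eq_bigr => w _; ring.
have E2 : S = \sum_z \sum_w (mult G z w)%:R * (- v' w * (v z - v w)).
  rewrite E1 exchange_big /=; apply: eq_bigr => z _; apply: eq_bigr => w _.
  by rewrite mult_sym; ring.
have E : S + S = \sum_z \sum_w (mult G z w)%:R * ((v' z - v' w) * (v z - v w)).
  rewrite {1}E1 E2 -big_split /=; apply: eq_bigr => z _.
  by rewrite -big_split /=; apply: eq_bigr => w _; ring.
by rewrite -E; lra.
Qed.

Lemma harmonic_connect v x y :
  (forall z, \sum_w (mult G z w)%:R * (v z - v w) = 0) ->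
  connect adj x y -> v x = v y.
Proof.
move=> hv.
have E0 : \sum_z \sum_w (mult G z w)%:R * ((v z - v w) * (v z - v w)) = 0.
  apply: (mulfI (_ : 2^-1 != 0)); first by rewrite invr_neq0.
  by rewrite -dirichlet mulr0 big1 // => z _; rewrite hv mulr0.
have ge0 z w : 0 <= (mult G z w)%:R * ((v z - v w) * (v z - v w)) :> R.
  by rewrite mulr_ge0 ?ler0n // -expr2 sqr_ge0.
have step z w : adj z w -> v z = v w.
  rewrite /adj /= => zw.
  have /(_ z isT) E1 := psumr_eq0P (fun z _ => sumr_ge0 _ (fun w _ => ge0 z w)) E0.
  have /(_ w isT)/eqP := psumr_eq0P (fun w _ => ge0 z w) E1.
  by rewrite !mulf_eq0 pnatr_eq0 -leqn0 leqNgt zw /= orbb subr_eq0 => /eqP.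
move=> /connectP[p + ->]; elim: p x => [|z p IH] x //= /andP[xz pz].
by rewrite (step _ _ xz) IH.
Qed.

Lemma unit_potential_uniq x y v v' : connect adj x y ->
  unit_potential x y v -> unit_potential x y v' -> v x - v y = v' x - v' y.
Proof.
move=> xy hv hv'; have := @harmonic_connect (fun z => v z - v' z) x y _ xy.
move=> H; suff: v x - v' x = v y - v' y by lra.
apply: H => z; rewrite -[RHS](subrr ((z == x)%:R - (z == y)%:R)) -{1}hv -hv'.
by rewrite -sumrB; apply: eq_bigr => w _; ring.
Qed.

Lemma unit_potential_exists x y : connect adj x y ->
  exists v, unit_potential x y v.
Proof.
move=> xy; pose ev (i : 'I_#|V|) : V := enum_val i.
pose L : 'M[R]_#|V| := \matrix_(i, j)
  ((i == j)%:R * (\sum_w (mult G (ev i) w)%:R) - (mult G (ev i) (ev j))%:R).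
have Lmul (f : 'I_#|V| -> R) i : \sum_j L i j * f j =
    \sum_w (mult G (ev i) w)%:R * (f i - f (enum_rank w)).
  transitivity (\sum_j (mult G (ev i) (ev j))%:R * (f i - f j)).
    rewrite (eq_bigr (fun j => (i == j)%:R * (\sum_w (mult G (ev i) w)%:R) * f j
      - (mult G (ev i) (ev j))%:R * f j)); last by move=> j _; rewrite mxE mulrBl.
    rewrite sumrB (bigD1 i) //= eqxx mul1r [X in _ + X - _]big1 ?addr0; last first.
      by move=> j ji; rewrite eq_sym (negbTE ji) !mul0r.
    rewrite [X in X * _](reindex ev) /=; last exact: onW_bij (enum_val_bij _).
    by rewrite mulr_suml -sumrB; apply: eq_bigr => j _; ring.
  rewrite [RHS](reindex ev) /=; last exact: onW_bij (enum_val_bij _).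
  by apply: eq_bigr => j _; rewrite /ev enum_valK.
have LT i j : L i j = L j i.
  rewrite !mxE mult_sym eq_sym; congr (_ - _).
  by case: eqP => [->|]; rewrite ?mul0r.
pose u : 'rV[R]_#|V| := \row_i ((ev i == x)%:R - (ev i == y)%:R).
have /submxP[c hc] : (u <= L)%MS.
  rewrite submxE; apply/eqP/rowP => k; rewrite !mxE.
  pose f w := cokermx L (enum_rank w) k.
  have fxy : f x = f y.
    apply: harmonic_connect xy => z.
    have := congr1 (fun M : 'M__ => M (enum_rank z) k) (mulmx_coker L).
    rewrite !mxE (Lmul (fun i => cokermx L i k)) /ev enum_rankK => E.
    by rewrite -[RHS]E.
  rewrite (reindex enum_rank) /=; last exact: onW_bij (enum_rank_bij _).
  rewrite (eq_bigr (fun w => (w == x)%:R * f w - (w == y)%:R * f w)); last first.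
    by move=> w _; rewrite mxE /ev enum_rankK mulrBl.
  have S a : \sum_w (w == a)%:R * f w = f a.
    rewrite (bigD1 a) //= eqxx mul1r big1 ?addr0 // => w wa.
    by rewrite (negbTE wa) mul0r.
  by rewrite sumrB !S fxy subrr.
exists (fun w => c ord0 (enum_rank w)) => z.
have := congr1 (fun M : 'rV__ => M ord0 (enum_rank z)) hc.
rewrite !mxE /ev enum_rankK => ->.
rewrite (eq_bigr (fun j => L (enum_rank z) j * c ord0 j)); last first.
  by move=> j _; rewrite LT mulrC.
by rewrite (Lmul (fun i => c ord0 i)) /ev enum_rankK.
Qed.

Lemma eff_resE x y v : connect adj x y -> unit_potential x y v ->
  eff_res x y = (v x - v y)%:E.
Proof.
move=> xy hv; rewrite /eff_res xy; congr _%:E.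
by case: xgetP => [r _ [v' hv' <-]|/(_ (v x - v y))[]];
  [exact: unit_potential_uniq | exists v].
Qed.

Lemma eff_resxx x : eff_res x x = 0%E.
Proof.
have h : unit_potential x x (fun=> 0).
  by move=> z; rewrite [RHS]subrr big1 // => w _; rewrite subrr mulr0.
by rewrite (eff_resE (connect0 _ _) h) subrr.
Qed.

End Resistance.

Definition average_res (R : realType) (n : nat) (G : mgraph 'I_n) : \bar R :=
  ('C(n, 2)%:R^-1%:E *
   \sum_(x < n) \sum_(y < n | (x < y)%N) eff_res R G x y)%E.

(* [G'] is [G] plus a new vertex [None], joined to [G] by exactly [s] edges. *)
Definition root_extension (V : finType) (G : mgraph V) (s : nat)
    (G' : mgraph (option V)) : Prop :=
  (forall x y, mult G' (Some x) (Some y) = mult G x y) /\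
  (\sum_x mult G' None (Some x) = s)%N.

(* Main.v *)
(* Join the root to s independent uniform vertices.  Sending 1/s units of current
   through each new edge and then along the unit current flow of G to x bounds
   R_{rho x} by the energy of this flow (Thomson's principle): the new edges
   contribute 1/s, and the flows from a and b to x have inner product
   (R_ax + R_bx - R_ab) / 2.  With a the mean of R_xy over independent uniform x
   and y, the s diagonal terms have mean a and the s(s-1) others a/2, and a <= A(G). *)
Require Import Defs.
From mathcomp Require Import all_boot all_order all_algebra.
From mathcomp Require Import constructive_ereal reals ereal.
From mathcomp Require Import boolp.
From mathcomp Require Import ring lra zify.

Set Implicit Arguments.
Unset Strict Implicit.
Unset Printing Implicit Defensive.

Import Order.TTheory GRing.Theory Num.Theory.

Local Open Scope ring_scope.

(** * Uniform averages and sampling *)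

Section Mean.
Variables (R : realFieldType) (V : finType).
Hypothesis V_gt0 : (0 < #|V|)%N.

Definition mean (f : V -> R) : R := #|V|%:R^-1 * \sum_x f x.

Lemma eq_mean f g : f =1 g -> mean f = mean g.
Proof. by move=> fg; rewrite /mean (eq_bigr g). Qed.

Lemma meanD f g : mean (fun x => f x + g x) = mean f + mean g.
Proof. by rewrite /mean big_split mulrDr. Qed.

Lemma meanB f g : mean (fun x => f x - g x) = mean f - mean g.
Proof. by rewrite /mean sumrB mulrBr. Qed.

Lemma meanZ k f : mean (fun x => k * f x) = k * mean f.
Proof. by rewrite /mean -mulr_sumr mulrCA. Qed.

Lemma mean_cst k : mean (fun=> k) = k.
Proof.
by rewrite /mean sumr_const -[k *+ _]mulr_natl mulKf // pnatr_eq0 -lt0n.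
Qed.

Lemma exists_le_mean f : exists x, f x <= mean f.
Proof.
have [x0 _] := card_gt0P V_gt0.
have [x _ min_x] := @arg_minP _ _ _ x0 predT f isT.
exists x; rewrite -[leLHS]mean_cst ler_wpM2l ?invr_ge0 //.
by apply: ler_sum => y _; exact: min_x.
Qed.

(* The right-hand side is the expectation of the left-hand side for [s]
   independent uniform vertices; the linear term [h] makes the induction,
   which fixes the vertices one at a time, go through. *)
Lemma exists_sample_le_mean (s : nat) (h : V -> R) (c : V -> V -> R) :
  exists2 t : seq V, size t = s &
    \sum_(a <- t) h a + \sum_(a <- t) \sum_(b <- t) c a b <=
    s%:R * mean h + s%:R * mean (fun a => c a a)
    + s%:R * (s%:R - 1) * mean (fun a => mean (c a)).
Proof.
elim: s h => [|s IH] h.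
  by exists [::]; rewrite // !big_nil !mul0r !addr0.
(* [f w] collects the terms that involve a first vertex [w], averaged over [s] further independent
   vertices. *)
pose f w := h w + (c w w + s%:R * (mean (c w) + mean (c^~ w))).
have [w le_w] := exists_le_mean f.
(* Once [w] is fixed, its cross terms with the remaining vertices are linear in them and are
   absorbed into [h]. *)
have [t size_t le_t] := IH (fun b => h b + (c w b + c b w)).
exists (w :: t); rewrite /= ?size_t // !big_cons.
under [X in _ + (_ + X) <= _]eq_bigr do rewrite big_cons.
have swap : mean (fun a => mean (c^~ a)) = mean (fun a => mean (c a)).
  by rewrite /mean -!mulr_sumr exchange_big.
move: le_t le_w; rewrite /f !meanD (meanZ s%:R) !meanD swap !big_split /= -natr1.
move: (mean h) (mean (fun a => c a a)) (mean (fun a => mean _)) => A B C.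
by move: s%:R => k; lra.
Qed.

End Mean.

(** * Dirichlet energy and effective resistance *)

Section Energy.
Variables (R : realType) (V : finType) (G : mgraph V).
Implicit Types (x y z w : V) (u v : V -> R).

(** The net current out of [z], positive at sources: the left-hand side in [unit_potential]. *)
Definition laplacian v z : R := \sum_w (mult G z w)%:R * (v z - v w).

(** By [dirichlet], the inner product of the gradient flows of [u] and [v], each edge counted
    once. *)
Definition energy u v : R := \sum_z u z * laplacian v z.

Lemma energyC u v : energy u v = energy v u.
Proof.
rewrite /energy !dirichlet; congr (_ * _).
by apply: eq_bigr => z _; apply: eq_bigr => w _; ring.
Qed.

Lemma energy_ge0 v : 0 <= energy v v.
Proof.
rewrite /energy dirichlet mulr_ge0 ?invr_ge0 //.
by apply: sumr_ge0 => z _; apply: sumr_ge0 => w _; rewrite mulr_ge0 // -expr2 sqr_ge0.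
Qed.

Lemma laplacianB u v z :
  laplacian (fun w => u w - v w) z = laplacian u z - laplacian v z.
Proof. by rewrite /laplacian -sumrB; apply: eq_bigr => w _; ring. Qed.

Lemma laplacianZ k v z : laplacian (fun w => k * v w) z = k * laplacian v z.
Proof. by rewrite /laplacian mulr_sumr; apply: eq_bigr => w _; ring. Qed.

Lemma laplacian_sum (I : Type) (r : seq I) (F : I -> V -> R) z :
  laplacian (fun w => \sum_(i <- r) F i w) z = \sum_(i <- r) laplacian (F i) z.
Proof.
rewrite /laplacian exchange_big; apply: eq_bigr => w _ /=.
by rewrite -sumrB mulr_sumr.
Qed.

Lemma energyBl u u' v : energy (fun w => u w - u' w) v = energy u v - energy u' v.
Proof. by rewrite /energy -sumrB; apply: eq_bigr => z _; ring. Qed.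

Lemma energyBB u v : energy (fun w => u w - v w) (fun w => u w - v w) =
  energy u u - 2 * energy u v + energy v v.
Proof.
rewrite energyBl (energyC u) (energyC v) !energyBl (energyC v u).
ring.
Qed.

Lemma sum_indicator u x : \sum_z u z * (z == x)%:R = u x.
Proof.
rewrite (bigD1 x) //= eqxx mulr1 big1 ?addr0 // => z /negbTE ->.
by rewrite mulr0.
Qed.

(** For [u = v] this identifies effective resistance with the energy of the unit current flow. *)
Lemma energy_unit_potential u v x y :
  unit_potential G x y v -> energy u v = u x - u y.
Proof.
move=> hv; rewrite /energy.
under eq_bigr => z _ do rewrite /laplacian hv mulrBr.
by rewrite sumrB !sum_indicator.
Qed.

Lemma connect_adj_sym x y : connect (adj G) x y = connect (adj G) y x.
Proof. by apply: sym_connect_sym => z w; rewrite /adj /= mult_sym. Qed.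

Lemma eff_resC x y : eff_res R G x y = eff_res R G y x.
Proof.
have [xy|nxy] := boolP (connect (adj G) x y); last first.
  by rewrite /eff_res (connect_adj_sym y) (negbTE nxy).
have [v hv] := unit_potential_exists R xy.
(* The negated potential drives the reversed current. *)
rewrite (eff_resE xy hv) (@eff_resE _ _ _ _ _ (fun w => -1 * v w)).
- by congr _%:E; ring.
- by rewrite connect_adj_sym.
by move=> z; rewrite [LHS]laplacianZ /laplacian hv mulN1r opprB.
Qed.

Lemma eff_res_ge0 x y : (0 <= eff_res R G x y)%E.
Proof.
have [xy|nxy] := boolP (connect (adj G) x y); last first.
  by rewrite /eff_res (negbTE nxy) leey.
have [v hv] := unit_potential_exists R xy.
by rewrite (eff_resE xy hv) lee_fin -(energy_unit_potential v hv) energy_ge0.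
Qed.

Section Connected.
Hypothesis connG : forall x y, connect (adj G) x y.

Lemma eff_res_fin x y : eff_res R G x y = (fine (eff_res R G x y))%:E.
Proof. by have [v hv] := unit_potential_exists R (connG x y); rewrite (eff_resE _ hv). Qed.

Lemma fine_eff_resE x y v : unit_potential G x y v ->
  fine (eff_res R G x y) = v x - v y.
Proof. by move=> hv; rewrite (eff_resE _ hv). Qed.

(** Polarization: the drop is the inner product of the unit flows from [a] and [b] to [x], and their
    difference is the unit flow from [a] to [b]. *)
Lemma unit_potential_drop a b x v : unit_potential G b x v ->
  v a - v x = 2^-1 * (fine (eff_res R G a x) + fine (eff_res R G b x)
                      - fine (eff_res R G a b)).
Proof.
move=> hv; have [u hu] := unit_potential_exists R (connG a x).
have huv : unit_potential G a b (fun w => u w - v w).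
  by move=> z; rewrite [LHS]laplacianB /laplacian hu hv; ring.
have := energyBB u v.
rewrite (energy_unit_potential _ huv) (energy_unit_potential _ hu).
rewrite !(energy_unit_potential _ hv) => E.
rewrite (fine_eff_resE hu) (fine_eff_resE hv) (fine_eff_resE huv).
have := energyC u v.
rewrite (energy_unit_potential _ hu) (energy_unit_potential _ hv).
lra.
Qed.

End Connected.

End Energy.

(** * Adding a root, and Thomson's principle *)

Section RootGraph.
Variables (R : realType) (V : finType) (G : mgraph V) (m : V -> nat).

Definition root_mult (x y : option V) : nat :=
  match x, y with
  | None, None => 0
  | Some x, None | None, Some x => m x
  | Some x, Some y => mult G x y
  end.

Lemma root_mult_sym x y : root_mult x y = root_mult y x.
Proof. by case: x y => [x|] [y|] //=; exact: mult_sym. Qed.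

Lemma root_mult_irr x : root_mult x x = 0%N.
Proof. by case: x => //= x; exact: mult_irr. Qed.

Definition root_graph := MGraph root_mult_sym root_mult_irr.

Lemma sum_option (F : option V -> R) : \sum_x F x = F None + \sum_x F (Some x).
Proof.
rewrite (bigD1 None) //=; congr (_ + _).
rewrite (reindex_omap Some id) /=; last by case.
by apply: eq_bigl => x; rewrite eqxx.
Qed.

Lemma connect_root_graph a x : (0 < m a)%N -> connect (adj G) a x ->
  connect (adj root_graph) None (Some x).
Proof.
move=> ma /connectP[p hp ->].
apply: (@connect_trans _ _ (Some a)); first exact: connect1.
apply/connectP; exists (map Some p); last by rewrite last_map.
by rewrite path_map.
Qed.

(* Thomson's principle against the flow given by 1/s on each of the s new edges
   and by the gradient of [g] on G. *)
Lemma root_resistance_le (s : nat) x (v : option V -> R) (g : V -> R) :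
  (0 < s)%N -> (\sum_a m a)%N = s ->
  unit_potential root_graph None (Some x) v ->
  (forall z, laplacian G g z = s%:R^-1 * (m z)%:R - (z == x)%:R) ->
  v None - v (Some x) <= s%:R^-1 + energy G g g.
Proof.
move=> s_gt0 sum_m hv hg; pose u z := v (Some z).
have s0 : s%:R != 0 :> R by rewrite pnatr_eq0 -lt0n.
have sumR : \sum_a (m a)%:R = s%:R :> R by rewrite -sum_m natr_sum.
(* The energy of [v] splits into the part on G and the part on the new edges. *)
have E1 : v None - v (Some x) =
    energy G u u + \sum_a (m a)%:R * (v None - u a) ^+ 2.
  rewrite -(energy_unit_potential v hv) /energy sum_option /laplacian sum_option /=.
  rewrite mul0r add0r mulr_sumr addrC.
  under [X in X + _]eq_bigr => z _ do rewrite sum_option /= mulrDr addrC.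
  rewrite big_split /= -addrA -big_split /=; congr (_ + _).
  by apply: eq_bigr => a _; rewrite /u; ring.
have E2 : energy G u g = s%:R^-1 * (\sum_a (m a)%:R * u a) - v (Some x).
  rewrite /energy; under eq_bigr => z _ do rewrite hg mulrBr.
  rewrite sumrB sum_indicator mulr_sumr; congr (_ - _).
  by apply: eq_bigr => a _; ring.
(* Squared deviation of the true root currents from the test current 1/s. Its nonnegativity, added
   to that of the energy of [u - g], gives the bound. *)
have E3 : \sum_a (m a)%:R * (v None - u a - s%:R^-1) ^+ 2 =
    \sum_a (m a)%:R * (v None - u a) ^+ 2
    - 2 * (v None - s%:R^-1 * \sum_a (m a)%:R * u a) + s%:R^-1.
  rewrite (eq_bigr (fun a => (m a)%:R * (v None - u a) ^+ 2
    - 2 * s%:R^-1 * v None * (m a)%:R + 2 * s%:R^-1 * ((m a)%:R * u a)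
    + s%:R^-1 ^+ 2 * (m a)%:R)); last by move=> a _; ring.
  by rewrite !big_split /= sumrN -!mulr_sumr sumR; field.
have : 0 <= \sum_a (m a)%:R * (v None - u a - s%:R^-1) ^+ 2.
  by apply: sumr_ge0 => a _; rewrite mulr_ge0 ?sqr_ge0.
have := energy_ge0 G (fun z => u z - g z).
rewrite energyBB E2 E3; lra.
Qed.

End RootGraph.

(** * The root joined to a sample of vertices *)

Lemma sum_count_mem (R : nzRingType) (V : finType) (t : seq V) (F : V -> R) :
  \sum_x (count_mem x t)%:R * F x = \sum_(a <- t) F a.
Proof.
elim: t => [|a t IH]; first by rewrite big_nil big1 // => x _; rewrite mul0r.
rewrite big_cons -IH [in RHS](bigD1 a) //= addrA.
rewrite (bigD1 a) //= eqxx natrD mulrDl mul1r; congr (_ + _).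
by apply: eq_bigr => x; rewrite eq_sym => /negbTE ->.
Qed.

Lemma sum_count_mem_size (V : finType) (t : seq V) :
  (\sum_x count_mem x t)%N = size t.
Proof.
elim: t => [|a t IH]; first by rewrite big1.
rewrite /= big_split /= IH (bigD1 a) //= eqxx big1 // => x.
by rewrite eq_sym => /negbTE ->.
Qed.

Lemma root_sample_resistance_le (R : realType) (V : finType) (G : mgraph V)
    (t : seq V) x (r := fun x y => fine (eff_res R G x y)) :
  (forall x y, connect (adj G) x y) -> (0 < size t)%N ->
  exists2 q : R,
    eff_res R (root_graph G (fun a => count_mem a t)) None (Some x) = q%:E &
    q <= (size t)%:R^-1 + (size t)%:R^-1 ^+ 2 *
      \sum_(a <- t) \sum_(b <- t) 2^-1 * (r a x + r b x - r a b).
Proof.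
move=> connG t_gt0; set H := root_graph _ _.
have /choice[phi hphi] a := unit_potential_exists R (connG a x).
have conn : connect (adj H) None (Some x).
  case: t t_gt0 @H => // a t _ /=; apply: connect_root_graph (connG a x).
  by rewrite /= eqxx.
have [v hv] := unit_potential_exists R conn.
exists (v None - v (Some x)); first exact: eff_resE.
set k : R := (size t)%:R^-1.
(* Superposition of the unit flows to [x] from the sampled vertices, each scaled by 1/s. *)
pose g z := k * \sum_(b <- t) phi b z.
have Lg z : laplacian G g z = k * (count_mem z t)%:R - (z == x)%:R.
  rewrite laplacianZ laplacian_sum.
  under eq_bigr => b _ do rewrite [laplacian _ _ _]hphi.
  rewrite sumrB mulrBr -(sum_count_mem t (fun b => (z == b)%:R)).
  under eq_bigr => b _ do rewrite eq_sym.
  rewrite (sum_indicator (fun b => (count_mem b t)%:R)) big_const_seq count_predT.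
  rewrite iter_addr_0 -[_ *+ size t]mulr_natl mulrA mulVf ?mul1r //.
  by rewrite pnatr_eq0 -lt0n.
have := root_resistance_le t_gt0 (sum_count_mem_size t) hv Lg.
move/le_trans; apply; rewrite lerD2l le_eqVlt; apply/orP; left; apply/eqP.
rewrite /energy.
(* The test flow enters with 1/s at each sampled vertex and leaves at [x], so its energy is the mean
   drop of [g] from the sample to [x]. *)
transitivity (\sum_(a <- t) k * (g a - g x)).
  under eq_bigr => z _ do rewrite Lg mulrBr.
  rewrite sumrB sum_indicator -(sum_count_mem t (fun a => k * (g a - g x))).
  under [RHS]eq_bigr => z _ do rewrite 2!mulrBr.
  rewrite sumrB; congr (_ - _); first by apply: eq_bigr => z _; ring.
  rewrite -mulr_suml -natr_sum sum_count_mem_size mulrA mulfV ?mul1r //.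
  by rewrite pnatr_eq0 -lt0n.
rewrite mulr_sumr; apply: eq_bigr => a _.
rewrite /g -mulrBr -sumrB mulrA -expr2; congr (_ * _).
by apply: eq_bigr => b _; exact: unit_potential_drop.
Qed.

(** One sample has to serve all [x] at once, so the bound is averaged over [x] before the sample is
    chosen. *)
Lemma exists_rooted_average_le (R : realType) (V : finType) (G : mgraph V) (s : nat) :
  (0 < #|V|)%N -> (0 < s)%N -> (forall x y, connect (adj G) x y) ->
  exists2 G' : mgraph (option V), root_extension G s G' &
    (rooted_average R G' None <=
     ((2^-1 + s%:R^-1 * 2^-1) * mean (fun x => mean (fun y => fine (eff_res R G x y)))
      + s%:R^-1)%:E)%E.
Proof.
move=> V_gt0 s_gt0 connG; pose r x y := fine (eff_res R G x y).
have rxx a : r a a = 0 by rewrite /r eff_resxx.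
pose c a b := mean (fun x => 2^-1 * (r a x + r b x - r a b)).
have cE a b : c a b = 2^-1 * (mean (r a) + mean (r b) - r a b).
  by rewrite /c meanZ meanB meanD mean_cst.
have [t size_t le_t] := exists_sample_le_mean V_gt0 s (fun=> 0) c.
have t_gt0 : (0 < size t)%N by rewrite size_t.
exists (root_graph G (fun a => count_mem a t)).
  by split=> //=; rewrite sum_count_mem_size.
have /choice[q hq] x : exists q : R,
    eff_res R (root_graph G (fun a => count_mem a t)) None (Some x) = q%:E /\
    q <= s%:R^-1 + s%:R^-1 ^+ 2 *
      \sum_(a <- t) \sum_(b <- t) 2^-1 * (r a x + r b x - r a b).
  by have [q] := root_sample_resistance_le R x connG t_gt0; rewrite size_t; exists q.
(* The root contributes 0 and [option V] has one vertex more than [V], so the divisor is [#|V|]. *)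
have -> : rooted_average R (root_graph G (fun a => count_mem a t)) None =
    (mean q)%:E.
  rewrite /rooted_average card_option /= (bigD1 None) //= eff_resxx add0e.
  rewrite (reindex_omap Some id) /=; last by case.
  under eq_bigl => x do rewrite eqxx /=.
  by under eq_bigr => x _ do rewrite (hq x).1; rewrite sumEFin.
rewrite lee_fin -/r; set T := mean (fun x => mean (r x)).
have : mean q <= s%:R^-1 + s%:R^-1 ^+ 2 * \sum_(a <- t) \sum_(b <- t) c a b.
  have -> : \sum_(a <- t) \sum_(b <- t) c a b =
      mean (fun x => \sum_(a <- t) \sum_(b <- t) 2^-1 * (r a x + r b x - r a b)).
    rewrite /c /mean [in RHS]exchange_big mulr_sumr; apply: eq_bigr => a _ /=.
    by rewrite [in RHS]exchange_big mulr_sumr.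
  rewrite -meanZ -[X in _ <= X + _](mean_cst V_gt0) -meanD.
  rewrite /mean ler_wpM2l ?invr_ge0 //; apply: ler_sum => x _.
  exact: (hq x).2.
move/le_trans; apply.
have diag : mean (fun a => c a a) = T.
  by apply: eq_mean => a; rewrite cE rxx; lra.
(* Of the three resistances in [c a b], each has mean [T], and one enters with a minus sign. *)
have offdiag : mean (fun a => mean (c a)) = 2^-1 * T.
  rewrite (eq_mean (g := fun a => 2^-1 * T)) ?mean_cst // => a.
  by rewrite (eq_mean (cE a)) meanZ meanB meanD mean_cst // addrC addKr.
rewrite diag offdiag big1_eq mean_cst // mulr0 !add0r in le_t.
rewrite addrC lerD2r.
have s0 : s%:R != 0 :> R by rewrite pnatr_eq0 -lt0n.
apply: (le_trans (ler_wpM2l _ le_t)); first by rewrite exprn_ge0 // invr_ge0.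
by rewrite le_eqVlt; apply/orP; left; apply/eqP; field.
Qed.

(** * From the mean over ordered pairs to [average_res] *)

Theorem theorem2 (R : realType) (n : nat) (hn : (2 <= n)%N) (G : mgraph 'I_n)
    (s : nat) (hs : (1 <= s)%N) :
  exists G' : mgraph (option 'I_n),
    root_extension G s G' /\
    (rooted_average R G' None <=
       (1 / 2)%R%:E * average_res R G
       + (1 / (2 * s%:R))%R%:E * average_res R G + (1 / s%:R)%R%:E)%E.
Proof.
have V_gt0 : (0 < #|'I_n|)%N by rewrite card_ord (leq_trans _ hn).
have bin_gt0 : 0 < 'C(n, 2)%:R :> R by rewrite ltr0n bin_gt0.
have s_gt0 : 0 < s%:R :> R by rewrite ltr0n.
have [/forallP conn|] := boolP [forall x, forall y, connect (adj G) x y].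
  have connG x y : connect (adj G) x y by have /forallP := conn x.
  have [G' extG' le_G'] := exists_rooted_average_le R V_gt0 hs connG.
  exists G'; split=> //; apply: (le_trans le_G').
  pose r x y := fine (eff_res R G x y).
  pose S := \sum_(x < n) \sum_(y < n | (x < y)%N) r x y.
  have -> : average_res R G = ('C(n, 2)%:R^-1 * S)%:E.
    rewrite /average_res EFinM /S -sumEFin; congr (_ * _)%E.
    apply: eq_bigr => x _; rewrite -sumEFin.
    by apply: eq_bigr => y _; exact: eff_res_fin.
  have S_ge0 : 0 <= S.
    by apply: sumr_ge0 => x _; apply: sumr_ge0 => y _; rewrite fine_ge0 ?eff_res_ge0.
  (* Each unordered pair is counted twice, and the diagonal vanishes. *)
  have sum_r : \sum_x \sum_y r x y = 2 * S.
    have -> : 2 * S = S + \sum_(x < n) \sum_(y < n | (y < x)%N) r x y.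
      rewrite mulr_natl mulr2n; congr (_ + _).
      rewrite [RHS](exchange_big_dep xpredT) //=.
      by apply: eq_bigr => x _; apply: eq_bigr => y _; rewrite /r eff_resC.
    rewrite -big_split; apply: eq_bigr => x _ /=.
    rewrite (bigD1 x) //= {1}/r eff_resxx add0r (bigID (fun y : 'I_n => (x < y)%N)) /=.
    congr (_ + _); apply: eq_bigl => y; rewrite -val_eqE /=; lia.
  have -> : mean (fun x => mean (r x)) = n%:R^-1 ^+ 2 * (2 * S).
    by rewrite -sum_r /mean -mulr_sumr mulrA card_ord.
  have n_gt1 : 1 < n%:R :> R by rewrite ltr1n.
  have bin2R : 2 * 'C(n, 2)%:R = n%:R * (n%:R - 1) :> R.
    rewrite -natrM mulnC -[2%N]/(2`!) bin_ffact ffactnS ffactn1 natrM.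
    by rewrite -subn1 natrB // ltnW.
  have S_E : S = 'C(n, 2)%:R * ('C(n, 2)%:R^-1 * S) by rewrite mulVKf ?lt0r_neq0.
  have A_ge0 : 0 <= 'C(n, 2)%:R^-1 * S by rewrite mulr_ge0 ?invr_ge0 ?ler0n.
  rewrite -!EFinM -!EFinD lee_fin {1}S_E.
  move: ('C(n, 2)%:R^-1 * S) A_ge0 => A A_ge0.
  have n_gt0 : 0 < n%:R :> R by lra.
  (* Including the diagonal lowers the mean by the factor 1 - 1/n. *)
  have -> : n%:R^-1 ^+ 2 * (2 * ('C(n, 2)%:R * A)) = A - n%:R^-1 * A.
    by rewrite (mulrA 2) bin2R; field; rewrite lt0r_neq0.
  have nA_ge0 : 0 <= n%:R^-1 * A by rewrite mulr_ge0 ?invr_ge0 ?ler0n.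
  have k_ge0 : 0 <= 2^-1 + s%:R^-1 * 2^-1 :> R by rewrite addr_ge0 ?mulr_ge0 ?invr_ge0 ?ltW.
  have -> : 1 / 2 * A + 1 / (2 * s%:R) * A + 1 / s%:R =
      (2^-1 + s%:R^-1 * 2^-1) * A + s%:R^-1 by field; rewrite lt0r_neq0.
  by rewrite lerD2r ler_wpM2l // gerBl.
rewrite negb_forall => /existsP[x]; rewrite negb_forall => /existsP[y nxy].
have avg_pinfty : average_res R G = +oo%E.
  wlog lt_xy : x y nxy / (x < y)%N.
    move=> wlog_xy; have [xy|yx|/val_inj exy] := ltngtP x y; first exact: wlog_xy xy.
      by apply: wlog_xy yx; rewrite connect_adj_sym.
    by rewrite exy connect0 in nxy.
  have res_xy : eff_res R G x y = +oo%E by rewrite /eff_res (negbTE nxy).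
  rewrite /average_res (bigD1 x) //= (bigD1 y) //= res_xy.
  (* The other summands are nonnegative, hence not [-oo], so they cannot cancel the infinite
     term. *)
  rewrite [X in (X + _)%E]addye; last first.
    by rewrite gt_eqF // (lt_le_trans ltNy0) // sume_ge0 // => z _; exact: eff_res_ge0.
  rewrite addye ?gt0_muley ?lte_fin ?invr_gt0 // gt_eqF // (lt_le_trans ltNy0) //.
  by rewrite sume_ge0 // => z _; rewrite sume_ge0 // => w _; exact: eff_res_ge0.
(* The right-hand side is infinite, so any extension works; here all [s] edges go to [x]. *)
exists (root_graph G (fun a => if a == x then s else 0%N)); split.
  by split=> //=; rewrite -big_mkcond big_pred1_eq.
rewrite avg_pinfty !gt0_muley ?lte_fin ?divr_gt0 ?mulr_gt0 //.
by rewrite addye // leey.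
Qed.
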